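(* Let $B_1=\{(x,y)\in\mathbb{R}^2 : x^2+y^2<1\}$, let $r^2=x^2+y^2$, and let $h$ be the real analytic symmetric $2$-tensor on $B_1$ $$h=(x\,dx+y\,dy)^2+2r^2(x\,dx+y\,dy)(x\,dy-y\,dx)+r^2(x\,dy-y\,dx)^2 ,$$ which is a singular metric on $B_1$ with degeneracy locus $\{0\}$. Let $\delta:B_1\to\mathbb{R}$, $\delta(x,y):=-(x^2+y^2)=-r^2$. Then any singular gradient trajectory of $\delta$ with respect to $h$ with initial data $(x_0,y_0)\in B_1\setminus\{0\}$, that is, the solution of $\dot p(t)=\xi_h\delta(p(t))$, $p(0)=(x_0,y_0)$, spirals around the origin as the time $t$ goes to $+\infty$.
   Context: A singular metric on a real analytic connected manifold $M$ is a real analytic symmetric $2$-tensor $h$ on $M$ for which there is a real analytic subset $Y\subset M$ of codimension at least $1$ such that $h$ is positive definite on $M\setminus Y$ and $h(y)$ is only positive semi-definite (not positive definite) at each $y\in Y$; $Y$ is called the degeneracy locus of $h$. For a real analytic function $f:M\to\mathbb{R}$, $\nabla_h f$ denotes the vector field on $M\setminus Y$ dual to $df$ via $h$: $d_xf\cdot u=\langle\nabla_hf(x),u\rangle_h$ for all $x\in M\setminus Y$ and $u\in T_xM$. On $M=B_1\subset\mathbb{R}^2$ with the coordinates $(x,y)$, let $H$ be the symmetric matrix of $h$, $H^*$ its adjugate matrix (so $HH^*=H^*H=\det(H)\,\mathrm{Id}$), and $\partial f=(\partial_xf,\partial_yf)^T$. Define $\xi_hf:=H^*\,\partial f$, which equals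 $\det(H)\,\nabla_hf$ on $M\setminus Y$; it is a real analytic vector field on all of $B_1$. The singular gradient differential equation of $f$ relative to $h$ is $\dot p(t)=\xi_hf(p(t))$, $p(0)=p_0\notin Y$, and its solutions are the singular gradient trajectories of $f$ with respect to $h$. Products of $1$-forms in the formula for $h$ are symmetric products, so that the quadratic form is $h_{(x,y)}(u,v)=(xu+yv)^2+2r^2(xu+yv)(xv-yu)+r^2(xv-yu)^2$ for a tangent vector $(u,v)$. A curve $p:[0,+\infty)\to\mathbb{R}^2\setminus\{0\}$ spirals around the origin as $t\to+\infty$ if $p(t)\to 0$ and, writing $p(t)=|p(t)|(\cos\varphi(t),\sin\varphi(t))$ with $\varphi$ continuous, $|\varphi(t)|\to+\infty$ as $t\to+\infty$. *)

(* Defs.v *)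
From HB Require Import structures.
From mathcomp Require Import all_boot all_order all_algebra.
From mathcomp Require Import all_classical all_reals all_analysis.
From mathcomp Require Import ring.

Set Implicit Arguments.
Unset Strict Implicit.
Unset Printing Implicit Defensive.

Import Order.TTheory GRing.Theory Num.Theory.
Import numFieldNormedType.Exports.

Local Open Scope classical_set_scope.
Local Open Scope ring_scope.

(* Points and tangent vectors of the plane are column vectors. The library norm
   on 'cV[R]_2 is the sup norm, so the Euclidean one is defined here; the two
   induce the same topology. *)
Notation plane R := 'cV[R]_2.

Section Defs.
Variable R : realType.
Implicit Types (p u v a : plane R) (U V Y : set (plane R)).

Definition cx p : R := p 0 0.
Definition cy p : R := p 1 0.
Definition vec (x y : R) : plane R := \col_(i < 2) (if i == 0 then x else y).

Definition sqnorm p : R := cx p ^+ 2 + cy p ^+ 2.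
Definition enorm p : R := Num.sqrt (sqnorm p).

(* Sum of an absolutely convergent double power series at a, summed by
   homogeneous components. *)
Definition analytic_at (f : plane R -> R) a : Prop :=
  exists c : nat -> nat -> R, exists2 e : R, 0 < e &
    forall u, `|cx u| < e -> `|cy u| < e ->
      cvgn (series (fun n => \sum_(i < n.+1)
              `|c i (n - i)%N * cx u ^+ i * cy u ^+ (n - i)|)) /\
      series (fun n => \sum_(i < n.+1)
              c i (n - i)%N * cx u ^+ i * cy u ^+ (n - i)) @ \oo --> f (a + u).

Definition analytic_on U (f : plane R -> R) : Prop :=
  forall a, U a -> analytic_at f a.

Definition analytic_subset U Y : Prop :=
  Y `<=` U /\
  forall a, U a -> exists V, [/\ open V, V a, V `<=` U &
    exists n (g : 'I_n -> plane R -> R),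
      (forall i, analytic_on V (g i)) /\
      (forall p, V p -> (Y p <-> forall i, g i p = 0))].

(* The dimension of an analytic subset is the largest dimension of a
   submanifold it contains, so codimension >= 1 means that it contains no
   nonempty open set. *)
Definition codim_ge1 Y : Prop := Y° = set0.

Definition posdef (A : 'M[R]_2) : Prop :=
  forall v, v != 0 -> 0 < (v^T *m A *m v) 0 0.

Definition possemidef (A : 'M[R]_2) : Prop :=
  forall v, 0 <= (v^T *m A *m v) 0 0.

(* H p is the matrix, in the coordinates (x, y), of the 2-tensor at p. The
   manifold is a connected open subset U of the plane. *)
Definition singular_metric U (H : plane R -> 'M[R]_2) Y : Prop :=
  [/\ open U, connected U,
      (forall p, U p -> (H p)^T = H p),
      (forall i j, analytic_on U (fun p => H p i j)) &
      [/\ analytic_subset U Y, codim_ge1 Y,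
          (forall p, U p -> ~ Y p -> posdef (H p)) &
          (forall p, Y p -> possemidef (H p) /\ ~ posdef (H p))]].

Definition partials (f : plane R -> R) p : plane R :=
  \col_(i < 2) 'D_(delta_mx i 0) f p.

Definition xi (H : plane R -> 'M[R]_2) (f : plane R -> R) p : plane R :=
  \adj (H p) *m partials f p.

(* Derivative at t of a curve defined on I; one-sided at an endpoint of I. *)
Definition has_derivative_within (I : set R) (p : R -> plane R) (t : R) v
    : Prop :=
  (s - t)^-1 *: (p s - p t) @[s --> within I t^'] --> v.

(* Only the values of p on [0, T[ are relevant; T may be +oo. *)
Definition time_domain (T : \bar R) : set R :=
  [set t | 0 <= t /\ (t%:E < T)%E].

Definition singular_gradient_trajectory U (H : plane R -> 'M[R]_2)
    (f : plane R -> R) (p0 : plane R) (T : \bar R) (p : R -> plane R) : Prop :=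
  p 0 = p0 /\
  forall t, time_domain T t ->
    U (p t) /\ has_derivative_within (time_domain T) p t (xi H f (p t)).

Definition spirals_around_origin (p : R -> plane R) : Prop :=
  [/\ (forall t, 0 <= t -> p t != 0),
      p t @[t --> +oo] --> (0 : plane R) &
      exists phi : R -> R,
        [/\ {within `[0, +oo[, continuous phi},
            (forall t, 0 <= t ->
               p t = enorm (p t) *: vec (cos (phi t)) (sin (phi t))) &
            `|phi t| @[t --> +oo] --> +oo]].

Definition B1 : set (plane R) := [set p | sqnorm p < 1].

(* 1-forms at a point are row vectors. *)
Definition sym_prod (a b : 'rV[R]_2) : 'M[R]_2 :=
  2^-1 *: (a^T *m b + b^T *m a).

Definition xdx_ydy p : 'rV[R]_2 := (vec (cx p) (cy p))^T.
Definition xdy_ydx p : 'rV[R]_2 := (vec (- cy p) (cx p))^T.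

Definition hmetric p : 'M[R]_2 :=
  sym_prod (xdx_ydy p) (xdx_ydy p)
  + (2 * sqnorm p) *: sym_prod (xdx_ydy p) (xdy_ydx p)
  + sqnorm p *: sym_prod (xdy_ydx p) (xdy_ydx p).

Lemma hmetric_quadratic_form (x y u v : R) :
  ((vec u v)^T *m hmetric (vec x y) *m vec u v) 0 0 =
  (x * u + y * v) ^+ 2
  + 2 * (x ^+ 2 + y ^+ 2) * (x * u + y * v) * (x * v - y * u)
  + (x ^+ 2 + y ^+ 2) * (x * v - y * u) ^+ 2.
Proof.
rewrite /hmetric /sym_prod /xdx_ydy /xdy_ydx /sqnorm /cx /cy.
by do ?rewrite ?(mxE, big_ord_recl, big_ord0) /=; field.
Qed.

Definition delta p : R := - sqnorm p.

End Defs.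

Arguments B1 R : clear implicits.
Arguments hmetric {R} p.
Arguments delta {R} p.

(* Main.v *)
(* On B1 the equation reads z' = -2 |z|^4 (1 - i) z with z = x + iy. Hence |z|^-4
   grows linearly and, in the time s with ds = 2 |z|^4 dt, log z moves along
   -1 + i: every solution is a logarithmic spiral, known in closed form.
   Uniqueness needs no Lipschitz estimate. For two solutions z and w with the
   same initial value, rho = |z|^2 and sigma = |w|^2 solve rho' = -4 rho^3, so
   (rho - sigma)^2 is nonincreasing and rho = sigma; then |z - w|^2 is
   nonincreasing as well. *)
Require Import Defs.
From HB Require Import structures.
From mathcomp Require Import all_boot all_order all_algebra.
From mathcomp Require Import all_classical all_reals all_analysis.
From mathcomp Require Import ring.

Import Order.TTheory GRing.Theory Num.Theory.
Import numFieldNormedType.Exports.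

Local Open Scope classical_set_scope.
Local Open Scope ring_scope.

(** * Polynomial functions of two variables are analytic *)

(** The support of [F] lies in the square of side [N], and every antidiagonal meeting that square
    has index below [N + N]. This passes from summation by homogeneous components to the double sum
    of a polynomial. *)
Lemma sum_antidiagonal (V : nmodType) (N : nat) (F : nat -> nat -> V) :
  (forall i j, (N <= i)%N || (N <= j)%N -> F i j = 0) ->
  \sum_(n < N + N) \sum_(i < n.+1) F i (n - i)%N =
  \sum_(i < N) \sum_(j < N) F i j.
Proof.
move=> F0.
(* The inner range is made independent of [n], padding with zeros, so that the two sums can be
   exchanged. *)
transitivity (\sum_(n < N + N) \sum_(i < N) if (i <= n)%N then F i (n - i)%N else 0).
  apply: eq_bigr => n _; rewrite -big_mkcond/=.
  rewrite -(big_mkord xpredT (fun i => F i (n - i)%N)).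
  rewrite -(big_mkord (fun i => i <= n)%N (fun i => F i (n - i)%N)).
  transitivity (\sum_(0 <= i < n.+1 | (i < N)%N) F i (n - i)%N).
    rewrite [RHS]big_mkcond; apply: eq_bigr => i _.
    by case: ltnP => // Ni; rewrite F0 ?Ni.
  rewrite [LHS](big_nat_widen _ _ (N + N)) ?ltn_ord//.
  rewrite [RHS](big_nat_widen _ _ (N + N)) ?leq_addr//.
  by apply: eq_bigl => i; rewrite andbC ltnS.
rewrite exchange_big/=; apply: eq_bigr => i _.
rewrite -(big_mkord xpredT (fun j => F i j)).
rewrite -(big_mkord xpredT (fun n => if (i <= n)%N then F i (n - i)%N else 0)).
rewrite (big_cat_nat (n := i))//=; last by rewrite ltnW// ltn_addr.
rewrite big_nat_cond big1 ?add0r; last first.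
  by move=> j /andP[/andP[_ ji] _]; rewrite leqNgt ji.
(* Reindexing by [n = j + i] leaves [j < N + N - i], a range that contains all [j < N]; the terms
   beyond [N] vanish. *)
rewrite -{1}[X in \sum_(X <= _ < _) _]add0n big_addn.
rewrite [RHS](big_nat_widen _ _ (N + N - i))/=; last first.
  by rewrite leq_subRL ?leq_add2r; [exact: ltnW|rewrite ltnW ?ltn_addr].
rewrite [RHS]big_mkcond; apply: eq_bigr => j _.
by rewrite leq_addl addnK; case: ltnP => // Nj; rewrite F0 ?Nj ?orbT.
Qed.

Section Analytic.
Context {R : realType}.
Implicit Types (f g : plane R -> R) (a u p : plane R).

(* The outer variable of P stands for cx u, the inner one for cy u. *)
Definition poly2_at f a := exists P : {poly {poly R}},
  forall u, f (a + u) = P.[(cx u)%:P].[cy u].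

Lemma poly2_at_cst (k : R) a : poly2_at (fun=> k) a.
Proof. by exists k%:P%:P => u; rewrite !hornerE. Qed.

Lemma poly2_at_cx a : poly2_at (@cx R) a.
Proof. by exists ((cx a)%:P%:P + 'X) => u; rewrite !hornerE /cx mxE. Qed.

Lemma poly2_at_cy a : poly2_at (@cy R) a.
Proof. by exists ((cy a)%:P%:P + 'X%:P) => u; rewrite !hornerE /cy mxE. Qed.

Lemma poly2_atD f g a :
  poly2_at f a -> poly2_at g a -> poly2_at (fun p => f p + g p) a.
Proof. by move=> [P fP] [Q gQ]; exists (P + Q) => u; rewrite !hornerE fP gQ. Qed.

Lemma poly2_atM f g a :
  poly2_at f a -> poly2_at g a -> poly2_at (fun p => f p * g p) a.
Proof. by move=> [P fP] [Q gQ]; exists (P * Q) => u; rewrite !hornerE fP gQ. Qed.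

(** The coefficients of the polynomial serve as the power series. Its homogeneous components vanish
    from degree [N + N] on, so both series are eventually constant, whatever the radius. *)
Lemma poly2_at_analytic f a : poly2_at f a -> analytic_at f a.
Proof.
move=> [P fP].
(* [N] exceeds the degree in each of the two variables. *)
pose N := maxn (size P) (\max_(i < size P) size (P`_i)%R).
pose c (i j : nat) := P`_i`_j.
have sPN i : (size (P`_i)%R <= N)%N.
  have [Pi|iP] := leqP (size P) i; first by rewrite (nth_default _ Pi) size_poly0.
  apply: leq_trans (leq_maxr _ _).
  exact: (@leq_bigmax _ (fun i : 'I_(size P) => size (P`_i)%R) (Ordinal iP)).
have c0 i j : (N <= i)%N || (N <= j)%N -> c i j = 0.
  rewrite /c => /orP[Ni|Nj].
    by rewrite (nth_default _ (leq_trans (leq_maxl _ _) Ni)) coef0.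
  by rewrite [LHS]nth_default// (leq_trans (sPN i)).
have big_stable (F : nat -> R) : (forall n, (N + N <= n)%N -> F n = 0) ->
    series F @ \oo --> \sum_(n < N + N) F n.
  move=> F0; apply: cvg_near_cst; near=> n.
  have Nn : (N + N <= n)%N by near: n; exact: nbhs_infty_ge.
  rewrite /series/= (big_cat_nat (n := N + N))//= [X in _ + X]big_nat_cond.
  rewrite [X in _ + X]big1 ?addr0 ?big_mkord// => i /andP[/andP[Ni _] _].
  exact: F0.
(* In total degree at least [N + N], one of the exponents [i] and [n - i] is at least [N]. *)
have vanish n i : (N + N <= n)%N -> (i < n.+1)%N -> c i (n - i)%N = 0.
  move=> Nn ilen; apply: c0; case: leqP => //= iN.
  rewrite leq_subRL; last by rewrite -ltnS.
  by rewrite (leq_trans _ Nn)// leq_add2r ltnW.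
exists c, 1 => // u _ _; split.
  apply/cvg_ex; eexists; apply: big_stable => n Nn.
  by rewrite big1// => i _; rewrite vanish// !mul0r normr0.
have -> : f (a + u) = \sum_(n < N + N) \sum_(i < n.+1)
    c i (n - i)%N * cx u ^+ i * cy u ^+ (n - i).
  rewrite (@sum_antidiagonal _ N (fun i j => c i j * cx u ^+ i * cy u ^+ j)); last first.
    by move=> i j /c0 ->; rewrite !mul0r.
  rewrite fP (@horner_coef_wide _ N P) ?leq_maxl// horner_sum.
  apply: eq_bigr => i _; rewrite -polyC_exp hornerM hornerC.
  rewrite (@horner_coef_wide _ N)//.
  by rewrite mulr_suml; apply: eq_bigr => j _; rewrite /c mulrAC.
apply: big_stable => n Nn.
by rewrite big1// => i _; rewrite vanish// !mul0r.
Unshelve. all: by end_near. Qed.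

End Analytic.

(** * The Euclidean plane, the unit disc, and the singular metric *)

Lemma ord2_ind (P : 'I_2 -> Prop) : P 0 -> P 1 -> forall i, P i.
Proof.
move=> P0 P1 [[|[|//]] i2].
- by rewrite (_ : Ordinal i2 = 0)//; apply: val_inj.
- by rewrite (_ : Ordinal i2 = 1)//; apply: val_inj.
Qed.

Section Plane.
Context {R : realType}.
Implicit Types (p u v : plane R).

Lemma plane_eqP p u : cx p = cx u -> cy p = cy u -> p = u.
Proof.
move=> px py; apply/matrixP => i j; rewrite (ord1 j).
by move: i; apply: ord2_ind.
Qed.

Lemma cx_vec (x y : R) : cx (vec x y) = x. Proof. by rewrite /cx mxE. Qed.

Lemma cy_vec (x y : R) : cy (vec x y) = y. Proof. by rewrite /cy mxE. Qed.

Lemma vec_eta p : p = vec (cx p) (cy p).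
Proof. by apply: plane_eqP; rewrite ?cx_vec ?cy_vec. Qed.

Lemma vec_scale (a x y : R) : a *: vec x y = vec (a * x) (a * y).
Proof. by apply: plane_eqP; rewrite ?cx_vec ?cy_vec /cx /cy mxE !mxE. Qed.

Lemma sqnorm_ge0 p : 0 <= sqnorm p.
Proof. by rewrite addr_ge0 ?sqr_ge0. Qed.

Lemma sqnorm_eq0 p : (sqnorm p == 0) = (p == 0).
Proof.
apply/idP/eqP => [|->]; last by rewrite /sqnorm /cx /cy !mxE !expr0n addr0.
rewrite paddr_eq0 ?sqr_ge0// !sqrf_eq0 => /andP[/eqP px /eqP py].
by apply: plane_eqP; rewrite ?px ?py /cx /cy mxE.
Qed.

Lemma sqnorm_gt0 p : (0 < sqnorm p) = (p != 0).
Proof. by rewrite lt_def sqnorm_ge0 sqnorm_eq0 andbT. Qed.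

Lemma continuous_cx : continuous (@cx R).
Proof. exact: coord_continuous. Qed.

Lemma continuous_cy : continuous (@cy R).
Proof. exact: coord_continuous. Qed.

Lemma continuous_sqnorm : continuous (@sqnorm R).
Proof.
move=> p; have cvg_sqr (f : plane R -> R) : continuous f ->
    f x ^+ 2 @[x --> nbhs p] --> f p ^+ 2.
  move=> fc; rewrite expr2; under eq_fun do rewrite expr2.
  by apply: (@cvgM R _ (nbhs p) (nbhs_filter p)); exact: fc.
apply: (@cvgD _ R^o _ (nbhs p) (nbhs_filter p)); apply: cvg_sqr;
  [exact: continuous_cx|exact: continuous_cy].
Qed.

Lemma cvg_plane {T : Type} {F : set_system T} {FF : Filter F}
    (f : T -> plane R) (l : plane R) :
  cx (f t) @[t --> F] --> cx l -> cy (f t) @[t --> F] --> cy l ->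
  f t @[t --> F] --> l.
Proof.
move=> fx fy; apply/cvg_ballP => e e0.
near=> t.
have lx : ball (cx l) e (cx (f t)).
  by near: t; move/cvg_ballP : fx; exact.
have ly : ball (cy l) e (cy (f t)).
  by near: t; move/cvg_ballP : fy; exact.
by split=> // i j; rewrite (ord1 j); move: i; apply: ord2_ind.
Unshelve. all: by end_near. Qed.

Lemma open_B1 : open (B1 R).
Proof.
rewrite (_ : B1 R = @sqnorm R @^-1` [set x | x < 1])//.
by apply: open_comp => [p _|]; [exact: continuous_sqnorm|exact: open_lt].
Qed.

Lemma sqnormZ (a : R) p : sqnorm (a *: p) = a ^+ 2 * sqnorm p.
Proof. by rewrite /sqnorm /cx /cy !mxE !exprMn mulrDr. Qed.

(** The disc is star-shaped: it is the union of the segments from the origin to its points, and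
    these all share the origin. *)
Lemma connected_B1 : connected (B1 R).
Proof.
pose segment p : set (plane R) := (fun t : R => t *: p) @` `[0, 1].
rewrite (_ : B1 R = \bigcup_(p in B1 R) segment p); last first.
  apply/seteqP; split=> [p pB|p [q qB [t]]].
    by exists p => //; exists 1; rewrite ?scale1r//= in_itv/= ler01 lexx.
  rewrite /= in_itv/= => /andP[t0 t1] <-; rewrite /B1/= sqnormZ.
  by rewrite (le_lt_trans _ qB)// ler_piMl ?sqnorm_ge0// expr_le1.
apply: bigcup_connected.
  exists 0 => p _; exists 0; last by rewrite scale0r.
  by rewrite /= in_itv/= lexx ler01.
move=> p _; apply: connected_continuous_connected.
  exact: segment_connected.
apply: continuous_subspaceT => t; exact: scalel_continuous.
Qed.

(** If the origin were interior to its singleton, [vec t 0] would vanish for all small nonzero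
    [t]. *)
Lemma interior_origin : ([set 0] : set (plane R))° = set0.
Proof.
apply/seteqP; split=> // p; rewrite /interior => p0.
have p_eq0 : p = 0 := nbhs_singleton p0; rewrite p_eq0 in p0.
have vec_cvg : vec (t : R) 0 @[t --> (0 : R)^'] --> (0 : plane R).
  apply: cvg_plane; rewrite [X in _ --> X]mxE.
    under eq_fun do rewrite cx_vec.
    exact: nbhs_dnbhs.
  by under eq_fun do rewrite cy_vec; exact: cvg_cst.
have : \forall t \near (0 : R)^', vec t 0 = 0 :> plane R by exact: (vec_cvg _ p0).
move=> vec0; have : \forall t \near (0 : R)^', False.
  near=> t; have : t != 0 by near: t; exact: nbhs_dnbhs_neq.
  move=> /eqP; apply; rewrite -(cx_vec t 0).
  have -> : vec t 0 = 0 by near: t.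
  by rewrite /cx mxE.
by move/filter_ex => [].
Unshelve. all: by end_near. Qed.

Lemma hmetricE p : let x := cx p in let y := cy p in let r2 := sqnorm p in
  [/\ hmetric p 0 0 = x * x - 2 * r2 * (x * y) + r2 * (y * y),
      hmetric p 0 1 = x * y + r2 * (x * x - y * y) - r2 * (x * y),
      hmetric p 1 0 = hmetric p 0 1 &
      hmetric p 1 1 = y * y + 2 * r2 * (x * y) + r2 * (x * x)].
Proof.
move=> x y r2; rewrite /hmetric /sym_prod /xdx_ydy /xdy_ydx -/x -/y -/r2.
by split; do ?rewrite ?(mxE, big_ord_recl, big_ord0) /=; field.
Qed.

(** Completing the square: with A = xu + yv and B = xv - yu, the form A^2 + 2 r^2 AB + r^2 B^2
    equals (A + r^2 B)^2 + r^2 (1 - r^2) B^2. *)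
Lemma quadratic_form_hmetric p v :
  (v^T *m hmetric p *m v) 0 0 =
  (cx p * cx v + cy p * cy v + sqnorm p * (cx p * cy v - cy p * cx v)) ^+ 2 +
  sqnorm p * (1 - sqnorm p) * (cx p * cy v - cy p * cx v) ^+ 2.
Proof.
rewrite (vec_eta v) [in LHS](vec_eta p) hmetric_quadratic_form.
by rewrite /sqnorm !cx_vec !cy_vec; ring.
Qed.

Lemma posdef_hmetric p : B1 R p -> p <> 0 -> posdef (hmetric p).
Proof.
move=> pB /eqP; rewrite -sqnorm_gt0 => r0 v v0; rewrite quadratic_form_hmetric.
set A := cx p * cx v + _; set B := _ - _ * _; set r := sqnorm p in r0 *.
(* Lagrange's identity: as [p] and [v] are nonzero, [A] and [B] cannot both vanish. If [B] is zero
   the form is [A ^+ 2]; otherwise its second square is positive because [0 < r < 1]. *)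
have AB : A ^+ 2 + B ^+ 2 = r * sqnorm v by rewrite /A /B /r /sqnorm; ring.
have r1 : 0 < r * (1 - r) by rewrite mulr_gt0// subr_gt0.
have [B0|B0] := eqVneq B 0.
  move: AB; rewrite B0 expr0n/= !mulr0 !addr0 => ->.
  by rewrite mulr_gt0// sqnorm_gt0.
by rewrite ltr_wpDl ?sqr_ge0// mulr_gt0// exprn_even_gt0.
Qed.

Lemma hmetric0 : hmetric (0 : plane R) = 0.
Proof.
have x0 : cx (0 : plane R) = 0 by rewrite /cx mxE.
have y0 : cy (0 : plane R) = 0 by rewrite /cy mxE.
have [] := hmetricE (0 : plane R); rewrite /sqnorm x0 y0 => h00 h01 h10 h11.
apply/matrixP => i j; rewrite [RHS]mxE; move: i j.
by apply: ord2_ind; apply: ord2_ind;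
  rewrite ?h10 (h00, h01, h11) !(mulr0, expr0n, addr0, subr0, mul0r).
Qed.

Lemma singular_metric_hmetric : singular_metric (B1 R) hmetric [set 0].
Proof.
have r2P a : poly2_at (@sqnorm R) a.
  rewrite /sqnorm; apply: poly2_atD; under eq_fun do rewrite expr2;
    by apply: poly2_atM; (exact: poly2_at_cx || exact: poly2_at_cy).
split; [exact: open_B1|exact: connected_B1| | |split].
- move=> p _; apply/matrixP => i j; rewrite mxE; move: i j.
  have [_ _ h10 _] := hmetricE p.
  by apply: ord2_ind; apply: ord2_ind.
- move=> i j a _; apply: poly2_at_analytic.
  (* The entries are written with sums, products and constants only, the operations under which
     [poly2_at] has been shown to be stable. *)
  have h00 : (fun p => hmetric p 0 0 : R) =
      fun p => cx p * cx p + -2 * (sqnorm p * (cx p * cy p)) +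
               sqnorm p * (cy p * cy p).
    by apply: funext => p; have [-> _ _ _] := hmetricE p; ring.
  have h01 : (fun p => hmetric p 0 1 : R) =
      fun p => cx p * cy p + sqnorm p * (cx p * cx p + -1 * (cy p * cy p)) +
               -1 * (sqnorm p * (cx p * cy p)).
    by apply: funext => p; have [_ -> _ _] := hmetricE p; ring.
  have h10 : (fun p => hmetric p 1 0 : R) = fun p => hmetric p 0 1.
    by apply: funext => p; have [_ _ -> _] := hmetricE p.
  have h11 : (fun p => hmetric p 1 1 : R) =
      fun p => cy p * cy p + 2 * (sqnorm p * (cx p * cy p)) +
               sqnorm p * (cx p * cx p).
    by apply: funext => p; have [_ _ _ ->] := hmetricE p; ring.
  move: i j; apply: ord2_ind; apply: ord2_ind;
    rewrite ?h10 (h00, h01, h11);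
    do !(apply: poly2_atD || apply: poly2_atM || exact: poly2_at_cx ||
         exact: poly2_at_cy || exact: r2P || exact: poly2_at_cst).
- split=> [p ->|a aB]; first by rewrite /B1/= (eqP (_ : sqnorm 0 == 0)) ?sqnorm_eq0.
  exists (B1 R); split => //; first exact: open_B1.
  (* The origin is the zero set of the single analytic function [sqnorm]. *)
  exists 1%N, (fun=> @sqnorm R); split=> [_ p _|p _].
    exact/poly2_at_analytic/r2P.
  split=> [->|/(_ ord0)/eqP]; last by rewrite sqnorm_eq0 => /eqP.
  by move=> _; apply/eqP; rewrite sqnorm_eq0.
- exact: interior_origin.
- by move=> p pB p0; exact: posdef_hmetric.
- move=> p ->; rewrite hmetric0; split=> [v|]; first by rewrite mulmx0 mul0mx mxE.
  (* At the origin the form is zero, so any nonzero vector, here (1, 1), refutes definiteness. *)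
  move=> /(_ (const_mx 1)); rewrite mulmx0 mul0mx mxE ltxx => /(_ _)/notF; apply.
  by apply/eqP => /matrixP/(_ 0 0)/eqP; rewrite !mxE oner_eq0.
Qed.

End Plane.

(** * Difference quotients, one-sided limits and monotonicity on a time interval *)

Section Derivatives.
Context {R : realType}.
Implicit Types (x y u v f : R -> R) (t l : R) (q : R -> plane R).

Lemma cvg_is_derive (V W : normedModType R) (f : V -> W) (a d : V) (l : W) :
  h^-1 *: (f (h *: d + a) - f a) @[h --> 0^'] --> l -> is_derive a d f l.
Proof.
move=> fl; split; first by apply/cvg_ex; exists l.
exact: (@cvg_lim _ (@norm_hausdorff _ _)).
Qed.

Definition slope f t s := (s - t)^-1 * (f s - f t).

(** The substitution s = h + t turns the quotient with h tending to 0 behind [is_derive] into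
    [slope], the form taken by the coordinates of [has_derivative_within]. *)
Lemma slope_is_derive f t l :
  slope f t s @[s --> t^'] --> l <-> is_derive t 1 f l.
Proof.
have near_dnbhs (P : set R) : (\forall h \near 0^', P (h + t)) = (\forall s \near t^', P s).
  rewrite !near_withinE [RHS](@near_shift _ R^o 0 t (fun s => s != t -> P s)).
  congr (nbhs _ _); apply/funext => h; apply/propext => /=.
  by rewrite !subr0 -[_ + t == t]subr_eq0 addrK.
have slopeE : h^-1 *: (f (h *: 1 + t) - f t) @[h --> 0^'] =
    slope f t s @[s --> t^'].
  apply/funext => A; rewrite -[RHS](near_dnbhs (slope f t @^-1` A)).
  congr (dnbhs _ _); apply/funext => h.
  by rewrite /slope/= addrK /GRing.scale/= mulr1.
rewrite -slopeE; split; first exact: cvg_is_derive.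
move=> [/cvg_ex[l' fl'] <-].
by rewrite (_ : 'D_1 f t = l')//; apply: (@cvg_lim _ (@norm_hausdorff _ _)).
Qed.

(** For s different from t, f(s) is (s - t) times the slope plus f(t); a right derivative thus gives
    right continuity. *)
Lemma slope_cvg_right f t l :
  slope f t s @[s --> t^'+] --> l -> f s @[s --> t^'+] --> f t.
Proof.
move=> fl; have : (s - t) * slope f t s + f t @[s --> t^'+] --> (t - t) * l + f t.
  apply: cvgD; last exact: cvg_cst.
  apply: cvgM => //; apply: cvgB; last exact: cvg_cst.
  exact: cvg_at_right_filter.
rewrite subrr mul0r add0r; apply: cvg_trans; apply: near_eq_cvg.
near=> s; have st : s != t by rewrite gt_eqF//; near: s; exact: nbhs_right_gt.
by rewrite /slope mulrA mulfV ?subr_eq0// mul1r subrK.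
Unshelve. all: by end_near. Qed.

(** At positive times the derivative within the time domain is therefore an ordinary two-sided one;
    only time 0 calls for one-sided limits. *)
Lemma time_domain_nbhs (T : \bar R) t :
  0 < t -> (t%:E < T)%E -> nbhs t (time_domain T).
Proof.
move=> t0 tT; near=> s; split; first by apply: ltW; near: s; exact: lt_nbhsr.
near: s; case: T tT => [r| |]// => [tr|_]; last first.
  by apply: nearW => s; rewrite ltry.
rewrite lte_fin in tr; under eq_near do rewrite lte_fin; exact: lt_nbhsl.
Unshelve. all: by end_near. Qed.

Lemma time_domain_at_right (T : \bar R) :
  (0 < T)%E -> \forall s \near 0^'+, time_domain T s.
Proof.
move=> T0; near=> s; split; first exact: ltW.
near: s; case: T T0 => [r| |]// => [r0|_]; last first.
  by apply: nearW => s; rewrite ltry.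
rewrite lte_fin in r0; under eq_near do rewrite lte_fin; exact: nbhs_right_lt.
Unshelve. all: by end_near. Qed.

Lemma time_domainW (T : \bar R) t s :
  time_domain T t -> 0 <= s <= t -> time_domain T s.
Proof.
move=> [_ tT] /andP[s0 st]; split => //.
by apply: le_lt_trans tT; rewrite lee_fin.
Qed.

Lemma has_derivative_withinP (I : set R) q t (w : plane R) :
  has_derivative_within I q t w <->
  slope (@cx R \o q) t s @[s --> within I t^'] --> cx w /\
  slope (@cy R \o q) t s @[s --> within I t^'] --> cy w.
Proof.
have cxE s : cx ((s - t)^-1 *: (q s - q t)) = slope (@cx R \o q) t s.
  by rewrite /slope /cx/= !mxE.
have cyE s : cy ((s - t)^-1 *: (q s - q t)) = slope (@cy R \o q) t s.
  by rewrite /slope /cy/= !mxE.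
split=> [qw|[qx qy]].
  rewrite -(funext cxE) -(funext cyE).
  by split; [apply: (cvg_comp _ _ qw (@continuous_cx R w))|
             apply: (cvg_comp _ _ qw (@continuous_cy R w))].
by apply: cvg_plane; rewrite ?(funext cxE) ?(funext cyE).
Qed.

(** Monotonicity on the closed interval from 0 to [t]. Derivatives are at hand at positive times
    only, so right continuity at 0 is a separate hypothesis. *)
Lemma nonincreasing_time_domain (T : \bar R) f (df : R -> R) :
  (forall t, 0 < t -> (t%:E < T)%E -> is_derive t 1 f (df t)) ->
  (forall t, 0 < t -> (t%:E < T)%E -> df t <= 0) ->
  f s @[s --> 0^'+] --> f 0 ->
  forall t, time_domain T t -> f t <= f 0.
Proof.
move=> fdf df0 f0 t tT; have [+ _] := tT; rewrite le_eqVlt => /predU1P[<-//|tgt0].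
have itvT s : s \in `]0, t]%R -> 0 < s /\ (s%:E < T)%E.
  rewrite in_itv/= => /andP[s0 st]; split => //.
  by have [] : time_domain T s by apply: time_domainW tT _; rewrite ltW.
have sub s : s \in `]0, t[%R -> s \in `]0, t]%R.
  by rewrite !in_itv/= => /andP[-> /ltW].
have cf s : s \in `]0, t]%R -> {for s, continuous f}.
  move=> /itvT[s0 sT]; have [fs _] := fdf _ s0 sT.
  by apply: differentiable_continuous; exact/derivable1_diffP.
apply: (@ler0_derive1_le_cc _ f 0 t); rewrite ?in_itv/= ?lexx ?(ltW tgt0)//.
- by move=> s /sub/itvT[s0 sT]; have [] := fdf _ s0 sT.
- move=> s /sub/itvT[s0 sT]; rewrite derive1E; have [_ ->] := fdf _ s0 sT.
  exact: df0.
- apply/continuous_within_itvP => //; split => //.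
  + by move=> s /sub; exact: cf.
  + by apply: cvg_at_left_filter; apply: cf; rewrite in_itv/= tgt0/=.
Qed.

Lemma is_derive_sum_sqr x y t l k :
  is_derive t 1 x l -> is_derive t 1 y k ->
  is_derive t 1 (fun s => x s ^+ 2 + y s ^+ 2) (2 * (x t * l + y t * k)).
Proof.
move=> xl yk; have := is_deriveD (is_deriveX 2 xl) (is_deriveX 2 yk).
by move=> h; apply: is_derive_eq h _; rewrite /GRing.scale/= !expr1; ring.
Qed.

Lemma cvg_right_sum_sqr x y :
  x s @[s --> 0^'+] --> x 0 -> y s @[s --> 0^'+] --> y 0 ->
  x s ^+ 2 + y s ^+ 2 @[s --> 0^'+] --> x 0 ^+ 2 + y 0 ^+ 2.
Proof.
move=> x0 y0; apply: cvgD; rewrite !expr2;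
  by under eq_fun do rewrite expr2; apply: cvgM.
Qed.

(** The function x^2 + y^2 is nonnegative, starts at 0, and has derivative 2 (x x' + y y'), which is
    at most 0. *)
Lemma eq_of_dist_nonincreasing (T : \bar R) x y (dx dy : R -> R) :
  x 0 = 0 -> y 0 = 0 ->
  x s @[s --> 0^'+] --> x 0 -> y s @[s --> 0^'+] --> y 0 ->
  (forall t, 0 < t -> (t%:E < T)%E -> is_derive t 1 x (dx t)) ->
  (forall t, 0 < t -> (t%:E < T)%E -> is_derive t 1 y (dy t)) ->
  (forall t, 0 < t -> (t%:E < T)%E -> x t * dx t + y t * dy t <= 0) ->
  forall t, time_domain T t -> x t = 0 /\ y t = 0.
Proof.
move=> x0 y0 cx0 cy0 xdx ydy le0 t tT.
have : x t ^+ 2 + y t ^+ 2 <= x 0 ^+ 2 + y 0 ^+ 2.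
  apply: (@nonincreasing_time_domain T (fun s => x s ^+ 2 + y s ^+ 2)
    (fun s => 2 * (x s * dx s + y s * dy s))) => //.
  - by move=> s s0 sT; apply: is_derive_sum_sqr; [exact: xdx|exact: ydy].
  - by move=> s s0 sT; rewrite pmulr_rle0// le0.
  - exact: cvg_right_sum_sqr.
rewrite x0 y0 expr0n addr0 => le.
have : x t ^+ 2 + y t ^+ 2 == 0 by rewrite eq_le le addr_ge0 ?sqr_ge0.
by rewrite paddr_eq0 ?sqr_ge0// !sqrf_eq0 => /andP[/eqP -> /eqP ->].
Qed.

(** * Uniqueness for the planar system *)

Section Uniqueness.
Variables (T : \bar R) (x y u v : R -> R).
Let r s := x s ^+ 2 + y s ^+ 2.
Let w s := u s ^+ 2 + v s ^+ 2.
Hypotheses (x0 : x s @[s --> 0^'+] --> x 0) (y0 : y s @[s --> 0^'+] --> y 0)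
  (u0 : u s @[s --> 0^'+] --> u 0) (v0 : v s @[s --> 0^'+] --> v 0)
  (xu0 : x 0 = u 0) (yv0 : y 0 = v 0)
  (dx : forall t, 0 < t -> (t%:E < T)%E ->
    is_derive t 1 x (- 2 * r t ^+ 2 * (x t + y t)))
  (dy : forall t, 0 < t -> (t%:E < T)%E ->
    is_derive t 1 y (- 2 * r t ^+ 2 * (y t - x t)))
  (du : forall t, 0 < t -> (t%:E < T)%E ->
    is_derive t 1 u (- 2 * w t ^+ 2 * (u t + v t)))
  (dv : forall t, 0 < t -> (t%:E < T)%E ->
    is_derive t 1 v (- 2 * w t ^+ 2 * (v t - u t))).

Let rwE t : time_domain T t -> r t = w t.
Proof.
move=> tT; have dr s : 0 < s -> (s%:E < T)%E -> is_derive s 1 r (- 4 * r s ^+ 3).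
  move=> s0 sT; have := is_derive_sum_sqr _ _ _ _ _ (dx _ s0 sT) (dy _ s0 sT).
  by move=> h; apply: is_derive_eq h _; rewrite /r; ring.
have dw s : 0 < s -> (s%:E < T)%E -> is_derive s 1 w (- 4 * w s ^+ 3).
  move=> s0 sT; have := is_derive_sum_sqr _ _ _ _ _ (du _ s0 sT) (dv _ s0 sT).
  by move=> h; apply: is_derive_eq h _; rewrite /w; ring.
have rw0 : (r - w) 0 = 0 by rewrite fctE /r /w /= xu0 yv0 !fctE subrr.
have rwc : (r - w) s @[s --> 0^'+] --> (r - w) 0.
  by apply: cvgB; exact: cvg_right_sum_sqr.
(* A scalar instance: the second coordinate is constantly 0. *)
have [] := @eq_of_dist_nonincreasing T (r - w) (cst 0)
  (fun s => - 4 * r s ^+ 3 - - 4 * w s ^+ 3) (cst 0) rw0 erefl rwc _ _ _ _ t tT.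
- exact: cvg_cst.
- by move=> s s0 sT; apply: is_deriveB; [exact: dr|exact: dw].
- move=> s s0 sT; rewrite !fctE mul0r addr0.
  (* The cubes are factored as r^3 - w^3 = (r - w)(r^2 + rw + w^2), and the last factor is
     nonnegative because [r] and [w] are. *)
  have -> : (r s - w s) * (- 4 * r s ^+ 3 - - 4 * w s ^+ 3) =
    - (4 * (r s - w s) ^+ 2 * (r s ^+ 2 + r s * w s + w s ^+ 2)) by ring.
  have r_ge0 : 0 <= r s by rewrite addr_ge0 ?sqr_ge0.
  have w_ge0 : 0 <= w s by rewrite addr_ge0 ?sqr_ge0.
  rewrite oppr_le0 mulr_ge0//; first exact: mulr_ge0 (sqr_ge0 _).
  by rewrite !addr_ge0 ?sqr_ge0// mulr_ge0.
by move=> /eqP; rewrite subr_eq0 => /eqP.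
Qed.

Lemma planar_unique t : time_domain T t -> x t = u t /\ y t = v t.
Proof.
move=> tT.
have [] := @eq_of_dist_nonincreasing T (x - u) (y - v)
  (fun s => - 2 * r s ^+ 2 * (x s + y s) - - 2 * w s ^+ 2 * (u s + v s))
  (fun s => - 2 * r s ^+ 2 * (y s - x s) - - 2 * w s ^+ 2 * (v s - u s))
  _ _ _ _ _ _ _ t tT.
- by rewrite !fctE xu0 subrr.
- by rewrite !fctE yv0 subrr.
- exact: cvgB.
- exact: cvgB.
- by move=> s s0 sT; apply: is_deriveB; [exact: dx|exact: du].
- by move=> s s0 sT; apply: is_deriveB; [exact: dy|exact: dv].
(* Once [w] is replaced by [r], the difference of the solutions obeys a linear system whose rotation
   part is skew and drops out of the inner product. *)
- move=> s s0 sT; rewrite -rwE; last by split => //; exact: ltW.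
  rewrite !fctE [leLHS](_ : _ =
    - (2 * r s ^+ 2 * ((x s - u s) ^+ 2 + (y s - v s) ^+ 2))); last by ring.
  by rewrite oppr_le0 !mulr_ge0 ?addr_ge0 ?sqr_ge0.
by move=> /eqP; rewrite subr_eq0 => /eqP -> /eqP; rewrite subr_eq0 => /eqP ->.
Qed.

End Uniqueness.

End Derivatives.

(** * The gradient equation in coordinates and uniqueness of its trajectories *)

Section Trajectories.
Context {R : realType}.
Implicit Types (p q : R -> plane R) (a : plane R) (T : \bar R) (t : R).

Lemma is_derive_cx a d : is_derive a d (@cx R) (cx d).
Proof.
apply: cvg_is_derive; apply: cvg_near_cst; near=> h.
have h0 : h != 0 by near: h; exact: nbhs_dnbhs_neq.
by rewrite /cx !mxE addrK /GRing.scale/= mulKf.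
Unshelve. all: by end_near. Qed.

Lemma is_derive_cy a d : is_derive a d (@cy R) (cy d).
Proof.
apply: cvg_is_derive; apply: cvg_near_cst; near=> h.
have h0 : h != 0 by near: h; exact: nbhs_dnbhs_neq.
by rewrite /cy !mxE addrK /GRing.scale/= mulKf.
Unshelve. all: by end_near. Qed.

Lemma derive_delta a d : 'D_d delta a = - 2 * (cx a * cx d + cy a * cy d).
Proof.
have [_ <-] : is_derive a d (@delta R) (- 2 * (cx a * cx d + cy a * cy d)) => //.
have := is_deriveN (is_deriveD (is_deriveX 2 (is_derive_cx a d))
  (is_deriveX 2 (is_derive_cy a d))).
by move=> h; apply: is_derive_eq h _; rewrite /GRing.scale/= !expr1; ring.
Qed.

Lemma adj2E (A : 'M[R]_2) :
  [/\ \adj A 0 0 = A 1 1, \adj A 0 1 = - A 0 1,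
      \adj A 1 0 = - A 1 0 & \adj A 1 1 = A 0 0].
Proof.
have l0 : lift 0 0 = 1 :> 'I_2 by apply: val_inj.
have l1 : lift 1 0 = 0 :> 'I_2 by apply: val_inj.
by split; rewrite !mxE /cofactor det_mx11 !mxE ?l0 ?l1 /= ?addn0 ?expr0 ?expr1
  ?mul1r ?mulN1r ?sqrrN ?expr1n ?mul1r.
Qed.

(** In complex notation the field is -2 |z|^4 (1 - i) z. The adjugate is linear in a 2 by 2 matrix.
    The part from (x dx + y dy)^2 annihilates the gradient -2p; the part from (x dy - y dx)^2 gives
    the inward component, and the mixed product gives the rotation. *)
Lemma xi_hmetric_delta a :
  cx (xi hmetric delta a) = - 2 * sqnorm a ^+ 2 * (cx a + cy a) /\
  cy (xi hmetric delta a) = - 2 * sqnorm a ^+ 2 * (cy a - cx a).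
Proof.
have [a00 a01 a10 a11] := adj2E (hmetric a).
have [h00 h01 h10 h11] := hmetricE a.
have dx : partials delta a 0 0 = - 2 * cx a.
  by rewrite mxE derive_delta /cx /cy !mxE/=; ring.
have dy : partials delta a 1 0 = - 2 * cy a.
  by rewrite mxE derive_delta /cx /cy !mxE/=; ring.
have mulE (A : 'M[R]_2) (v : plane R) i :
    (A *m v) i 0 = A i 0 * v 0 0 + A i 1 * v 1 0.
  by rewrite mxE !big_ord_recl big_ord0 addr0; congr (_ + A i _ * v _ 0);
    apply: val_inj.
split; rewrite [LHS]mulE ?(a00, a01, a10, a11) dx dy ?h10 (h01, h11) ?h00;
  by rewrite ?h01 /sqnorm; ring.
Qed.

Lemma trajectory_coordinates a T p :
  singular_gradient_trajectory (B1 R) hmetric delta a T p ->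
  forall t, 0 < t -> (t%:E < T)%E ->
  is_derive t 1 (@cx R \o p)
    (- 2 * sqnorm (p t) ^+ 2 * (cx (p t) + cy (p t))) /\
  is_derive t 1 (@cy R \o p)
    (- 2 * sqnorm (p t) ^+ 2 * (cy (p t) - cx (p t))).
Proof.
move=> [_ pT] t t0 tT; have tD := time_domain_nbhs _ _ t0 tT.
have [_ /has_derivative_withinP[px py]] := pT t (nbhs_singleton tD).
have [<- <-] := xi_hmetric_delta (p t).
have within_dnbhs : t^' `=>` within (time_domain T) t^'.
  by move=> P; rewrite /within/=; apply: filterS2 (nbhs_dnbhs tD) => s Ts; exact.
split; apply/slope_is_derive; [apply: cvg_trans px|apply: cvg_trans py];
  exact: cvg_app.
Qed.

Lemma trajectory_cvg_right a T p : (0 < T)%E ->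
  singular_gradient_trajectory (B1 R) hmetric delta a T p ->
  (@cx R \o p) s @[s --> 0^'+] --> (@cx R \o p) 0 /\
  (@cy R \o p) s @[s --> 0^'+] --> (@cy R \o p) 0.
Proof.
move=> T0 [_ pT]; have := pT 0; case; first by split.
move=> _ /has_derivative_withinP[px py].
have within_right : 0^'+ `=>` within (time_domain T) 0^'.
  move=> P PT; near=> s.
  have : s != 0 -> time_domain T s -> P s.
    by near: s; exact: (@cvg_within _ (nbhs (0 : R)) _ _ _ PT).
  apply; first by rewrite gt_eqF//; near: s; exact: nbhs_right_gt.
  by near: s; exact: time_domain_at_right.
split; apply: slope_cvg_right; [apply: cvg_trans px|apply: cvg_trans py];
  exact: cvg_app.
Unshelve. all: by end_near. Qed.

Lemma trajectory_unique a T p q :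
  singular_gradient_trajectory (B1 R) hmetric delta a T p ->
  singular_gradient_trajectory (B1 R) hmetric delta a T q ->
  forall t, time_domain T t -> p t = q t.
Proof.
(* The time domain contains [t], hence is nonempty, which forces [T] to be positive. *)
move=> pT qT t tT; have T0 : (0 < T)%E.
  by have [t0 tltT] := tT; apply: le_lt_trans tltT; rewrite lee_fin.
have [px py] := trajectory_cvg_right _ _ _ T0 pT.
have [qx qy] := trajectory_cvg_right _ _ _ T0 qT.
have dp := trajectory_coordinates _ _ _ pT.
have dq := trajectory_coordinates _ _ _ qT.
have pq0 : p 0 = q 0 by rewrite pT.1 qT.1.
have [] := @planar_unique R T (@cx R \o p) (@cy R \o p)
  (@cx R \o q) (@cy R \o q) px py qx qy (congr1 (@cx R) pq0) (congr1 (@cy R) pq0)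
  (fun s s0 sT => (dp s s0 sT).1) (fun s s0 sT => (dp s s0 sT).2)
  (fun s s0 sT => (dq s s0 sT).1) (fun s s0 sT => (dq s s0 sT).2) t tT.
exact: plane_eqP.
Qed.

(** A limit within a set persists within a smaller one. This makes a global solution comparable with
    one defined up to [T] only. *)
Lemma trajectory_restrict a T p :
  singular_gradient_trajectory (B1 R) hmetric delta a +oo%E p ->
  singular_gradient_trajectory (B1 R) hmetric delta a T p.
Proof.
move=> [p0 pT]; split=> // t tT.
have sub : time_domain T `<=` time_domain +oo%E.
  by move=> s [s0 _]; split; rewrite ?ltry.
have [pB dp] := pT t (sub t tT); split=> //.
by apply: cvg_trans dp; apply: cvg_app; exact: within_subset.
Qed.

(** * Solutions in closed form: logarithmic spirals *)

(** The arccosine of x / |a| determines the angle up to sign, and the sign of y selects it. *)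
Lemma polar_coordinates a : exists theta : R,
  a = enorm a *: vec (cos theta) (sin theta).
Proof.
have [->|a0] := eqVneq a 0.
  exists 0; rewrite /enorm (eqP (_ : sqnorm 0 == 0)) ?sqnorm_eq0//.
  by rewrite sqrtr0 scale0r.
have r0 : 0 < enorm a by rewrite sqrtr_gt0 sqnorm_gt0.
have r2 : enorm a ^+ 2 = cx a ^+ 2 + cy a ^+ 2 by rewrite sqr_sqrtr ?sqnorm_ge0.
pose c := cx a / enorm a.
have c2 : 1 - c ^+ 2 = (cy a / enorm a) ^+ 2.
  rewrite /c !expr_div_n r2; field.
  by rewrite -r2 expf_neq0// gt_eqF.
have c1 : -1 <= c <= 1.
  by rewrite -ler_norml -(@expr_le1 _ 2)// real_normK ?num_real// -subr_ge0 c2 sqr_ge0.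
have cosE : cos (acos c) = c by rewrite acosK// in_itv.
have sinE : sin (acos c) = `|cy a / enorm a| by rewrite sin_acos// c2 sqrtr_sqr.
have [y0|y0] := leP 0 (cy a).
  exists (acos c); rewrite vec_scale cosE sinE ger0_norm ?divr_ge0// ?ltW//.
  by rewrite /c ![enorm a * _]mulrC !divfK ?gt_eqF//; exact: vec_eta.
exists (- acos c); rewrite vec_scale cosN sinN cosE sinE ltr0_norm; last first.
  by rewrite pmulr_llt0 ?invr_gt0.
by rewrite opprK /c ![enorm a * _]mulrC !divfK ?gt_eqF//; exact: vec_eta.
Qed.

(* The integral of 2 |z|^4 over [0, t] along a solution with |z(0)| = r. *)
Definition spiral_time (r t : R) : R := ln (1 + 8 * r ^+ 4 * t) / 4.

(** In complex notation this is r exp(i theta) exp((-1 + i) s), where s is [spiral_time r t]. *)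
Definition spiral (r theta t : R) : plane R :=
  (r * expR (- spiral_time r t)) *:
    vec (cos (theta + spiral_time r t)) (sin (theta + spiral_time r t)).

Section Spiral.
Variables (r theta : R).
Hypothesis (r0 : 0 < r).

Let k0 : 0 < 8 * r ^+ 4. Proof. by rewrite mulr_gt0 ?exprn_gt0. Qed.

Let lin_gt0 t : 0 <= t -> 0 < 1 + 8 * r ^+ 4 * t.
Proof. by move=> t0; rewrite ltr_wpDr// mulr_ge0// ltW. Qed.

Lemma spiral_time_ge0 t : 0 <= t -> 0 <= spiral_time r t.
Proof.
by move=> t0; rewrite divr_ge0// ln_ge0// lerDl mulr_ge0// ltW.
Qed.

Lemma spiral_time0 : spiral_time r 0 = 0.
Proof. by rewrite /spiral_time mulr0 addr0 ln1 mul0r. Qed.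

Lemma expR_spiral_time t : 0 <= t ->
  expR (- spiral_time r t) ^+ 4 = (1 + 8 * r ^+ 4 * t)^-1.
Proof.
move=> t0; rewrite -expRM_natl mulrN [_ * spiral_time r t]mulrC divfK// expRN lnK// posrE.
exact: lin_gt0.
Qed.

(** The logarithm yields 2 r^4 / (1 + 8 r^4 t), and [expR_spiral_time] identifies this with twice
    the fourth power of the radius at time [t]. *)
Lemma is_derive_spiral_time t : 0 <= t ->
  is_derive t 1 (spiral_time r) (2 * (r * expR (- spiral_time r t)) ^+ 4).
Proof.
move=> t0; rewrite exprMn expR_spiral_time//.
pose lin s : R := 1 + 8 * r ^+ 4 * s.
have dlin : is_derive t 1 lin (8 * r ^+ 4).
  have h := is_deriveD (is_derive_cst (1 : R) t 1)
    (is_deriveZ (8 * r ^+ 4) (is_derive_id t (1 : R))).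
  by apply: is_derive_eq h _; rewrite add0r /GRing.scale/= mulr1.
have dln : is_derive (lin t) 1 (@ln R) (lin t)^-1 by apply: is_derive1_ln; exact: lin_gt0.
rewrite (_ : spiral_time r = 4^-1 \*: (@ln R \o lin)); last first.
  by apply/funext => s; rewrite /spiral_time mulrC.
apply: is_derive_eq (is_deriveZ 4^-1 (is_derive1_comp dln dlin)) _.
by rewrite /lin /GRing.scale/=; field; rewrite gt_eqF ?lin_gt0.
Qed.

Lemma spiral_time_cvgy : spiral_time r t @[t --> +oo] --> +oo.
Proof.
apply/cvgryPge => A; near=> t.
have t0 : 0 <= t by near: t; apply: nbhs_pinfty_ge; exact: num_real.
rewrite /spiral_time ler_pdivlMr// -(expRK (A * 4)) ler_ln ?posrE ?expR_gt0 ?lin_gt0//.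
(* The threshold for [t] is (exp(4A) - 1) / (8 r^4). *)
by rewrite -lerBlDl -ler_pdivrMl.
Unshelve. all: by end_near. Qed.

Lemma sqnorm_polar (s w : R) : sqnorm (s *: vec (cos w) (sin w)) = s ^+ 2.
Proof. by rewrite sqnormZ /sqnorm cx_vec cy_vec cos2Dsin2 mulr1. Qed.

Lemma spiral_radius_gt0 t : 0 < r * expR (- spiral_time r t).
Proof. by rewrite mulr_gt0 ?expR_gt0. Qed.

Lemma is_derive_spiral t : 0 <= t ->
  is_derive t 1 (@cx R \o spiral r theta) (cx (xi hmetric delta (spiral r theta t))) /\
  is_derive t 1 (@cy R \o spiral r theta) (cy (xi hmetric delta (spiral r theta t))).
Proof.
move=> t0; have [-> ->] := xi_hmetric_delta (spiral r theta t).
rewrite sqnorm_polar.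
have ds := is_derive_spiral_time _ t0.
have dexp := is_deriveZ r 
  (@is_derive1_comp _ _ (- spiral_time r) _ _ _ (is_derive_expR _) (is_deriveN ds)).
have dang := is_deriveD (is_derive_cst theta t 1) ds.
have dcos := @is_derive1_comp _ _ (cst theta + spiral_time r) _ _ _ (is_derive_cos _) dang.
have dsin := @is_derive1_comp _ _ (cst theta + spiral_time r) _ _ _ (is_derive_sin _) dang.
(* Each coordinate is displayed as a product of composites, the shape to which the product and chain
   rules apply. *)
have cxE : @cx R \o spiral r theta =
    (r \*: (@expR R \o - spiral_time r)) * (@cos R \o (cst theta + spiral_time r)).
  by apply/funext => s; rewrite /= /spiral vec_scale cx_vec.
have cyE : @cy R \o spiral r theta =
    (r \*: (@expR R \o - spiral_time r)) * (@sin R \o (cst theta + spiral_time r)).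
  by apply/funext => s; rewrite /= /spiral vec_scale cy_vec.
have cxt := congr1 (@^~ t) cxE; have cyt := congr1 (@^~ t) cyE.
rewrite /= in cxt cyt; rewrite cxt cyt cxE cyE.
split; [have h := is_deriveM dexp dcos|have h := is_deriveM dexp dsin];
  apply: is_derive_eq h _; rewrite !fctE/= /GRing.scale/=; ring.
Qed.

Lemma spiral_trajectory a : B1 R a -> a = r *: vec (cos theta) (sin theta) ->
  singular_gradient_trajectory (B1 R) hmetric delta a +oo%E (spiral r theta).
Proof.
move=> aB aE; split; first by rewrite /spiral spiral_time0 oppr0 expR0 mulr1 addr0.
move=> t [t0 _]; split.
  (* The radius never exceeds its initial value, because [spiral_time] is nonnegative; the curve
     stays in the disc. *)
  rewrite /B1/= sqnorm_polar; apply: le_lt_trans aB.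
  rewrite aE sqnorm_polar lerXn2r ?nnegrE ?(ltW r0) ?(ltW (spiral_radius_gt0 t))//.
  by rewrite ler_piMr ?(ltW r0)// -expR0 ler_expR oppr_le0 spiral_time_ge0.
(* The closed form is differentiable from both sides even at time 0, so the derivative within the
   time domain follows by restriction. *)
have [dx dy] := is_derive_spiral _ t0.
by apply/has_derivative_withinP; split; apply: cvg_within_filter;
  apply/slope_is_derive.
Qed.

(** As [spiral_time] tends to +oo, the radius tends to 0 and [theta + spiral_time r t] is a
    continuous angle tending to +oo. Agreement with [spiral] is asked at nonnegative times only,
    since a trajectory is arbitrary elsewhere. *)
Lemma spiral_spirals p : (forall t, 0 <= t -> p t = spiral r theta t) ->
  spirals_around_origin p.
Proof.
move=> pE; have enormE t : enorm (spiral r theta t) = r * expR (- spiral_time r t).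
  by rewrite /enorm sqnorm_polar sqrtr_sqr gtr0_norm// spiral_radius_gt0.
have radius0 : r * expR (- spiral_time r t) @[t --> +oo] --> 0.
  rewrite -[X in _ --> X](mulr0 r); apply: cvgM; first exact: cvg_cst.
  exact: (cvg_comp _ _ spiral_time_cvgy (@cvgr_expR R)).
(* Applied to [cos] and [sin], this handles both coordinates. *)
have bounded_cvg0 (g : R -> R) : (forall w, `|g w| <= 1) ->
    r * expR (- spiral_time r t) * g (theta + spiral_time r t) @[t --> +oo] --> 0.
  move=> g1; apply/norm_cvg0P.
  apply: (squeeze_cvgr _ (cvg_cst 0) radius0); near=> t.
  rewrite normr_ge0/= normrM gtr0_norm ?spiral_radius_gt0//.
  by rewrite ler_piMr// ltW// spiral_radius_gt0.
split.
- move=> t t0; rewrite pE// -sqnorm_gt0 sqnorm_polar exprn_gt0//.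
  exact: spiral_radius_gt0.
- suff : spiral r theta t @[t --> +oo] --> (0 : plane R).
    apply: cvg_trans; apply: near_eq_cvg; near=> t.
    by rewrite pE.
  apply: cvg_plane; rewrite [X in _ --> X]mxE /spiral.
    under eq_fun do rewrite vec_scale cx_vec.
    by apply: bounded_cvg0 => w; rewrite ler_norml cos_geN1 cos_le1.
  under eq_fun do rewrite vec_scale cy_vec.
  by apply: bounded_cvg0 => w; rewrite ler_norml sin_geN1 sin_le1.
- exists (fun t => theta + spiral_time r t); split.
  + apply/continuous_in_subspaceT => t; rewrite inE/= in_itv/= andbT => t0.
    apply: cvgD; first exact: cvg_cst.
    have [ds _] := is_derive_spiral_time _ t0.
    by apply: differentiable_continuous; exact/derivable1_diffP.
  + by move=> t t0; rewrite pE// enormE.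
  + apply/cvgryPge => A; near=> t; apply: le_trans (ler_norm _).
    rewrite -lerBlDl; near: t.
    by move/cvgryPge : spiral_time_cvgy; exact.
Unshelve. all: by end_near. Qed.

End Spiral.

End Trajectories.

Theorem proposition4p1 (R : realType) :
  singular_metric (B1 R) hmetric [set 0] /\
  forall p0 : plane R, B1 R p0 -> p0 <> 0 ->
    (exists p : R -> plane R,
       singular_gradient_trajectory (B1 R) hmetric delta p0 +oo%E p /\
       forall (T : \bar R) (q : R -> plane R),
         singular_gradient_trajectory (B1 R) hmetric delta p0 T q ->
         forall t : R, time_domain T t -> q t = p t) /\
    (forall p : R -> plane R,
       singular_gradient_trajectory (B1 R) hmetric delta p0 +oo%E p ->
       spirals_around_origin p).
Proof.
split; first exact: singular_metric_hmetric.
move=> p0 p0B /eqP p0_neq0.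
have [theta p0E] := polar_coordinates p0.
have r0 : 0 < enorm p0 by rewrite sqrtr_gt0 sqnorm_gt0.
have sol := spiral_trajectory _ _ r0 _ p0B p0E.
split=> [|p pT].
  exists (spiral (enorm p0) theta); split=> // T q qT.
  exact/trajectory_unique/trajectory_restrict/sol.
(* By uniqueness the given trajectory is the closed-form spiral at all nonnegative times. *)
apply: (spiral_spirals _ theta r0) => t t0.
by apply: trajectory_unique pT sol _ _; split; rewrite ?ltry.
Qed.
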